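(* (i) For every meager set $F\subseteq 2^\omega$ and every perfect tree $T\subseteq 2^{<\omega}$ there is a perfect tree $T'\subseteq T$ such that for every $n\in\omega$ the set $F+\underbrace{[T']+[T']+\dots+[T']}_{n\text{ times}}$ is meager in $2^\omega$. (ii) For every meager set $F\subseteq 2^\omega$ and every uniformly perfect tree $T\subseteq 2^{<\omega}$ there is a uniformly perfect tree $T'\subseteq T$ such that for every $n\in\omega$ the set $F+\underbrace{[T']+[T']+\dots+[T']}_{n\text{ times}}$ is meager in $2^\omega$.
   Context: A tree is a nonempty set $T\subseteq 2^{<\omega}$ closed under initial segments. Write $\mathrm{split}(T)=\{\sigma\in T:\sigma^\frown 0\in T\text{ and }\sigma^\frown 1\in T\}$ and $[T]=\{x\in 2^\omega:(\forall n\in\omega)\ x\upharpoonright n\in T\}$. $T$ is perfect if for every $\sigma\in T$ there is $\tau\in\mathrm{split}(T)$ with $\sigma\subseteq\tau$. $T$ is uniformly perfect if it is perfect and for every $n\in\omega$ either $2^n\cap T\subseteq\mathrm{split}(T)$ or $2^n\cap\mathrm{split}(T)=\emptyset$. On $2^\omega$, $+$ is coordinatewise addition modulo $2$, and $A+B=\{a+b:a\in A,\ b\in B\}$ for $A,B\subseteq 2^\omega$; for $n=0$ the displayed set is read as $F$ itself. *)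

(* Defs.v *)
From mathcomp Require Import all_boot all_order all_algebra.
From mathcomp Require Import all_classical topology cantor.

Set Implicit Arguments.
Unset Strict Implicit.
Unset Printing Implicit Defensive.

Local Open Scope classical_set_scope.

Definition nowhere_dense (X : topologicalType) (A : set X) : Prop :=
  interior (closure A) = set0.

Definition meager (X : topologicalType) (A : set X) : Prop :=
  exists N : nat -> set X,
    (forall i, nowhere_dense (N i)) /\ A = \bigcup_i N i.

(* Elements of 2^{<omega} are finite sequences of booleans, so that sigma^0 and
   sigma^1 are [rcons s false] and [rcons s true]. *)
Definition is_tree (T : set (seq bool)) : Prop :=
  T !=set0 /\ forall s t : seq bool, T t -> prefix s t -> T s.

Definition split_nodes (T : set (seq bool)) : set (seq bool) :=
  [set s | [/\ T s, T (rcons s false) & T (rcons s true)]].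

Definition level (n : nat) : set (seq bool) := [set s | size s = n].

Definition perfect_tree (T : set (seq bool)) : Prop :=
  is_tree T /\
  forall s, T s -> exists t, split_nodes T t /\ prefix s t.

Definition uniformly_perfect_tree (T : set (seq bool)) : Prop :=
  perfect_tree T /\
  forall n, level n `&` T `<=` split_nodes T \/
            level n `&` split_nodes T = set0.

(* [mkseq x n] is the restriction of x to n = {0, ..., n - 1}. *)
Definition branches (T : set (seq bool)) : set cantor_space :=
  [set x : cantor_space | forall n : nat, T (mkseq x n)].

Definition cantor_add (x y : cantor_space) : cantor_space :=
  fun i => x i (+) y i.

Definition cantor_sumset (A B : set cantor_space) : set cantor_space :=
  [set cantor_add a b | a in A & b in B].

(* F + A + ... + A with n summands A, associated to the left. *)
Definition cantor_iter_sumset (F A : set cantor_space) (n : nat) :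
    set cantor_space :=
  iter n (fun B => cantor_sumset B A) F.

(* Main.v *)
Require Import Defs.
From mathcomp Require Import all_boot all_order all_algebra.
From mathcomp Require Import all_classical topology cantor.

Set Implicit Arguments.
Unset Strict Implicit.
Unset Printing Implicit Defensive.

Local Open Scope classical_set_scope.

(** A meager set is swallowed by a set of the form
    [eventually_avoids f z = {x : x differs from z somewhere on almost every
    block [f k, f (k+1))}], and every such set is meager
    ([meager_sub_eventually_avoids], [meager_eventually_avoids]).  Such a set
    absorbs the addition of any set B that is small in the following sense.
    Group the blocks into longer blocks, the k-th of which consists of N k
    short ones.  If, on the k-th long block, the points of B show at most N k
    patterns, then these patterns can be distributed over the short blocks, one
    each, and z can be translated on each short block by the pattern assigned
    to it.  A point b of B shows one of the patterns p; on the short block of p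
    the point a + b disagrees with z + p because a disagrees with z.  Hence F + B
    is again contained in a set of the above form ([meager_sumset]).

    A sum of n branches of T' shows at most M ^ n patterns below a given height
    when T' has at most M nodes there, so it is enough to find T' having at most
    2 ^ k nodes at height g k, where g is prescribed in terms of F
    alone: with N k = 2 ^ ((k + 1) * k) all sums with n <= k summands are under
    control at stage k.  Such a T' is obtained from T by erasing splittings: a
    branch walks upwards through T, and a splitting node of T remains
    splitting only if its height is at least g c, where c is the number of
    splittings the walk has already used; at the other nodes the walk follows
    one fixed successor.  Only k splittings then fit below height g k.  If T is
    uniformly perfect, the number c depends only on the height, so that
    T' is uniformly perfect as well; the same construction therefore serves both
    statements. *)

(** * Agreement of points and the topology of the Cantor space *)

Definition agree (m n : nat) (x y : cantor_space) : Prop :=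
  forall i, m <= i < n -> x i = y i.

Lemma agree_nbhs n (x : cantor_space) : nbhs x (agree 0 n x).
Proof.
elim: n => [|n IHn]; first by apply: filterS filterT => y _ i; rewrite ltn0.
have cvgx : {ptws, nbhs x --> x} by exact: cvg_id.
have /pointwise_cvgP/(_ n)/(_ [set x n]) := cvgx.
rewrite nbhs_simpl /= => /(_ _)/wrap[]; first by exact: discrete_set1.
move=> xn; apply: filterS2 IHn xn => y xy yn i /= /[!ltnS]; rewrite leq_eqVlt.
by case/predU1P => [-> //|lin]; apply: xy.
Qed.

Lemma nbhs_agree (x : cantor_space) (U : set cantor_space) :
  nbhs x U -> exists n, agree 0 n x `<=` U.
Proof.
pose G := filter_from [set: nat] (fun n => agree 0 n x).
have FG : Filter G.
  apply: filter_from_filter; first by exists 0.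
  move=> m n _ _; exists (maxn m n) => // y xy.
  by split=> i /= lt_i; apply: xy; rewrite leq_max lt_i ?orbT.
have cvgG : {ptws, G --> x}.
  apply/pointwise_cvgP => t V /= Vxt; exists t.+1 => // y xy /=.
  by rewrite -xy ?ltnSn //; apply: nbhs_singleton.
by move=> /cvgG[n _ sub]; exists n.
Qed.

(** If every point y of the cylinder of x were in the closure of N, that cylinder
    would witness a nonempty interior. *)
Lemma nowhere_dense_avoid (N : set cantor_space) (x : cantor_space) n :
  nowhere_dense N ->
  exists y m, [/\ agree 0 n x y, n <= m & forall t, agree 0 m y t -> ~ N t].
Proof.
move=> ndN; apply: contrapT => noy.
have : interior (closure N) x.
  apply: filterS (agree_nbhs n x) => y xy U /nbhs_agree[m yU].
  apply: contrapT => NU0; apply: noy; exists y, (maxn n m).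
  split=> [//||t yt Nt]; first exact: leq_maxl.
  apply: NU0; exists t; split=> //; apply: yU => i /= lt_im.
  by apply: yt; rewrite leq_max lt_im orbT.
by rewrite ndN.
Qed.

(** * Meager sets and block partitions *)

Definition eventually_avoids (f : nat -> nat) (z : cantor_space) :
    set cantor_space :=
  [set x | exists K, forall k, K <= k -> ~ agree (f k) (f k.+1) x z].

Lemma leq_ltn_seq (f : nat -> nat) k : (forall k, f k < f k.+1) -> k <= f k.
Proof. by move=> f_lt; elim: k => // k IHk; apply: leq_ltn_trans IHk (f_lt k). Qed.

Lemma homo_leq_seq (f : nat -> nat) : (forall k, f k < f k.+1) ->
  {homo f : m n / m <= n}.
Proof. by move=> f_lt; apply: homo_leq leq_trans _ => // k; apply: ltnW. Qed.

Lemma glue_blocks (X : Type) (f : nat -> nat) (h : nat -> nat -> X) :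
  (forall k, f k < f k.+1) ->
  exists z : nat -> X, forall k i, f k <= i < f k.+1 -> z i = h k i.
Proof.
move=> f_lt; have exk i : exists k, i < f k.+1.
  by exists i; apply: (leq_ltn_trans (leq_ltn_seq i f_lt)).
exists (fun i => h (ex_minn (exk i)) i) => k i /andP[le_fk_i lt_i_fk].
case: ex_minnP => j lt_i_fj /(_ _ lt_i_fk) le_jk; congr (h _ i).
apply/eqP; rewrite eqn_leq le_jk /= leqNgt; apply/negP => lt_jk.
by have := leq_trans lt_i_fj (leq_trans (homo_leq_seq f_lt lt_jk) le_fk_i);
  rewrite ltnn.
Qed.

Lemma meagerS (A B : set cantor_space) : A `<=` B -> meager B -> meager A.
Proof.
move=> AB [N [ndN defB]]; exists (fun i => A `&` N i); split=> [i|].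
  rewrite /nowhere_dense -subset0 => x; rewrite -[in X in _ -> X](ndN i) /=.
  by apply: interiorS; apply: closure_subset; apply: subIsetr.
by rewrite -setI_bigcupr -defB; apply/esym/setIidPl.
Qed.

(** Freezing the threshold K gives a nowhere dense set: continuing a point by z
    from an arbitrary height on makes it match z on a whole block beyond K. *)
Lemma meager_eventually_avoids f z :
  (forall k, f k < f k.+1) -> meager (eventually_avoids f z).
Proof.
move=> f_lt.
exists (fun K => [set x | forall k, K <= k -> ~ agree (f k) (f k.+1) x z]).
split=> [K|]; last first.
  by apply/seteqP; split=> x [K]; [exists K|move=> _ ?; exists K].
rewrite /nowhere_dense -subset0 => x /nbhs_agree[m xcl].
pose k := maxn K m; pose y : cantor_space := fun i => if i < m then x i else z i.
have [|t /= [tK yt]] := xcl y _ _ (agree_nbhs (f k.+1) y).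
  by move=> i /= lt_im; rewrite /y lt_im.
apply: (tK k) => [|i /andP[le_fk_i lt_i_fk]]; first exact: leq_maxl.
rewrite -yt //= /y ltnNge (leq_trans _ le_fk_i) //.
by apply: leq_trans (leq_ltn_seq k f_lt); apply: leq_maxr.
Qed.

(** A single block pattern on [[m, n)] can be made to avoid finitely many
    nowhere dense sets at once, uniformly in the coordinates below m: the pairs
    (initial segment, set) are finitely many, and each costs one lengthening of
    the block. *)
Lemma nowhere_dense_avoid_block (N : nat -> set cantor_space) m k :
  (forall i, nowhere_dense (N i)) ->
  exists z n, m < n /\
    forall i x, i < k -> agree m n x z -> ~ N i x.
Proof.
move=> ndN.
suff [z [n [lt_mn avoid]]] : exists z n, m < n /\
    forall s i, (s, i) \in enum {: m.-tuple bool * 'I_k} ->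
    forall x, mkseq x m = s -> agree m n x z -> ~ N i x.
  exists z, n; split=> // i x lt_ik xz.
  have sz : size (mkseq x m) == m by rewrite size_mkseq.
  by apply: (avoid (Tuple sz) (Ordinal lt_ik)); rewrite ?mem_enum.
elim: (enum _) => [|[s i] l [z [n [lt_mn IH]]]]; first by exists point, m.+1.
have [y [n' [zy le_nn' Ny]]] := nowhere_dense_avoid
  (fun j => if j < m then nth false s j else z j) n (ndN i).
exists y, n'; split=> [|s' i']; first exact: leq_trans le_nn'.
have zym j : m <= j < n -> z j = y j.
  by case/andP=> le_mj lt_jn; rewrite -zy //= ltnNge le_mj.
rewrite inE => /predU1P[[-> ->]|/IH{}IH] x xs xy.
  apply: Ny => j /= lt_jn'; case: (ltnP j m) => [lt_jm|le_mj].
    by rewrite -zy /= ?lt_jm ?(ltn_trans lt_jm) // -xs nth_mkseq.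
  by rewrite xy ?le_mj.
apply: IH xs _ => j /andP[le_mj lt_jn]; rewrite zym ?le_mj ?lt_jn //.
by rewrite xy ?le_mj ?(leq_trans lt_jn).
Qed.

Lemma meager_sub_eventually_avoids (F : set cantor_space) : meager F ->
  exists f z, (forall k, f k < f k.+1) /\ F `<=` eventually_avoids f z.
Proof.
move=> [N [ndN ->]].
have /choice[e eP] : forall p : nat * nat, exists q : cantor_space * nat,
    p.1 < q.2 /\ forall i x, i < p.2 -> agree p.1 q.2 x q.1 -> ~ N i x.
  move=> [m k].
  by have [z [n zn]] := nowhere_dense_avoid_block m k ndN; exists (z, n).
pose f := fix f k := if k is j.+1 then (e (f j, j)).2 else 0.
have f_lt k : f k < f k.+1 by have [] := eP (f k, k).
have [z zP] := glue_blocks (fun k => (e (f k, k)).1) f_lt.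
exists f, z; split=> // x [i _ Nix]; exists i.+1 => k lt_ik xz.
have [_ /(_ i x lt_ik)] := eP (f k, k); apply=> // j jk.
by rewrite xz // (zP k).
Qed.

(** * Sums with sets having few patterns *)

Definition few_patterns (M m : nat) (B : set cantor_space) : Prop :=
  exists ps : seq cantor_space, size ps <= M /\
    forall x, B x -> exists2 p, p \in ps & agree 0 m x p.

Lemma few_patternsW M M' m B :
  M <= M' -> few_patterns M m B -> few_patterns M' m B.
Proof. by move=> le_M [ps [sz psP]]; exists ps; split=> //; apply: leq_trans le_M. Qed.

Lemma few_patterns_sumset M M' m A B : few_patterns M m A ->
  few_patterns M' m B -> few_patterns (M * M') m (cantor_sumset A B).
Proof.
move=> [ps [sz psP]] [qs [sz' qsP]].
exists [seq cantor_add p q | p <- ps, q <- qs]; split.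
  by rewrite size_allpairs leq_mul.
move=> _ [a /psP[p pps ap] [b /qsP[q qqs bq] <-]].
exists (cantor_add p q); first by apply/allpairsP; exists (p, q).
by move=> i lt_i; rewrite /cantor_add ap ?bq.
Qed.

Definition cantor_zero : cantor_space := fun=> false.

Lemma few_patterns_iter_sumset M m A n : few_patterns M m A ->
  few_patterns (M ^ n) m (cantor_iter_sumset [set cantor_zero] A n).
Proof.
move=> fewA; elim: n => [|n IHn]; last first.
  by rewrite expnSr; apply: few_patterns_sumset.
by exists [:: cantor_zero]; split=> // _ ->; exists cantor_zero; rewrite ?inE.
Qed.

Lemma iter_sumset_sub F A n : cantor_iter_sumset F A n `<=`
  cantor_sumset F (cantor_iter_sumset [set cantor_zero] A n).
Proof.
elim: n => [|n IHn] x /=.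
  move=> Fx; exists x => //; exists cantor_zero => //.
  by apply/funext => i; rewrite /cantor_add addbF.
case=> y /IHn[a Fa [b Bb <-]] [c Ac <-]; exists a => //.
exists (cantor_add b c); first by exists b => //; exists c.
by apply/funext => i; rewrite /cantor_add addbA.
Qed.

(** The k-th long block is [[f (idx k), f (idx k.+1))], which contains enough
    short blocks to devote one to each of the N k patterns of B.  The sum is
    swallowed by the set of points that avoid, on long blocks, the translate z'
    of z by the pattern devoted to each short block. *)
Lemma meager_sumset f z (N : nat -> nat) (idx : nat -> nat)
    (F B : set cantor_space) K :
  (forall k, f k < f k.+1) -> F `<=` eventually_avoids f z ->
  (forall k, idx k < idx k.+1) -> (forall k, idx k + N k <= idx k.+1) ->
  (forall k, K <= k -> few_patterns (N k) (f (idx k.+1)) B) ->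
  meager (cantor_sumset F B).
Proof.
move=> f_lt Fz idx_lt idxN fewB.
have /choice[ps psP] : forall k, exists ps, K <= k -> size ps <= N k /\
    forall x, B x -> exists2 p, p \in ps & agree 0 (f (idx k.+1)) x p.
  move=> k; have [/fewB[ps psP]|] := leqP K k; first by exists ps.
  by exists [::].
(* [q j] is the pattern assigned to the j-th short block. *)
have [q qP] := glue_blocks
  (fun k j => nth cantor_zero (ps k) (j - idx k)) idx_lt.
have [z' z'P] := glue_blocks (fun j l => z l (+) q j l) f_lt.
apply: (@meagerS _ (eventually_avoids (f \o idx) z')); last first.
  apply: meager_eventually_avoids => k /=.
  by apply: leq_trans (f_lt _) (homo_leq_seq f_lt (idx_lt k)).
move=> _ [a /Fz[K' aK'] [b Bb <-]]; exists (maxn K K') => k.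
rewrite geq_max => /andP[leKk leK'k] /= abz'.
have [szps /(_ b Bb)[p pps bp]] := psP k leKk.
pose j := idx k + index p (ps k).
have lt_j : j < idx k.+1.
  apply: leq_trans (idxN k); rewrite ltn_add2l.
  by apply: leq_trans szps; rewrite index_mem.
have le_j : idx k <= j by apply: leq_addr.
have qj : q j = p by rewrite (qP k) ?le_j // addKn nth_index.
apply: (aK' j) => [|l /andP[le_l lt_l]].
  by apply: leq_trans leK'k (leq_trans (leq_ltn_seq k idx_lt) le_j).
have lt_l' : l < f (idx k.+1) by apply: leq_trans lt_l (homo_leq_seq f_lt lt_j).
have := abz' l; rewrite lt_l' (leq_trans (homo_leq_seq f_lt le_j) le_l).
move=> /(_ isT); rewrite (z'P j) ?le_l // qj /cantor_add bp //.
exact: addIb.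
Qed.

(** * Erasing splittings of a perfect tree *)

Section Thinning.
Variables (T : set (seq bool)) (g : nat -> nat).

Definition may_split (s : seq bool) (c : nat) : bool :=
  `[< split_nodes T s /\ g c <= size s >].

(** Choices are numbered by splittings rather than by heights, so that a node is
    determined by as many bits as there are splittings below it.  At a node of T
    with a single successor, the second branch of the conditional selects that
    successor. *)
Fixpoint walk (w : nat -> bool) (n : nat) : seq bool * nat :=
  if n is m.+1 then
    let: (s, c) := walk w m in
    if may_split s c then (rcons s (w c), c.+1)
    else (rcons s (~~ `[< T (rcons s false) >]), c)
  else ([::], 0).

Definition thin_tree : set (seq bool) :=
  [set s | exists w n, s = (walk w n).1].

Lemma size_walk w n : size (walk w n).1 = n.
Proof.
elim: n => //= n; case: (walk w n) => s c /= <-.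
by case: ifP => _; rewrite size_rcons.
Qed.

Lemma thin_tree_walk s : thin_tree s -> exists w, s = (walk w (size s)).1.
Proof. by move=> [w [n ->]]; exists w; rewrite size_walk. Qed.

Lemma take_walk w m n : m <= n -> take m (walk w n).1 = (walk w m).1.
Proof.
elim: n => [|n IHn]; first by rewrite leqn0 => /eqP->.
rewrite leq_eqVlt => /predU1P[->|]; first by rewrite take_oversize ?size_walk.
rewrite ltnS => le_mn; rewrite -IHn //=; have := size_walk w n.
case: (walk w n) => s c /= szs.
by case: ifP => _; rewrite -cats1 takel_cat ?szs.
Qed.

Lemma walk_count_leqS w n : (walk w n).2 <= (walk w n.+1).2.
Proof. by rewrite /=; case: (walk w n) => s c /=; case: ifP => _ /=. Qed.

(** A walk reads only as many entries of w as it meets splittings; this is what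
    turns a bound on the counter into a bound on the number of nodes. *)
Lemma eq_walk w w' n : (forall c, c < (walk w n).2 -> w c = w' c) ->
  walk w n = walk w' n.
Proof.
elim: n => // n IHn eqw; have {}IHn : walk w n = walk w' n.
  by apply: IHn => c lt_c; apply/eqw/(leq_trans lt_c)/walk_count_leqS.
move: eqw; rewrite /= -IHn; case: (walk w n) => s c /=.
by case: ifP => //= _ ->.
Qed.

(** Splitting number k, counted from 0, is not granted below height [g k]. *)
Lemma walk_count_leq w n k : n <= g k -> (walk w n).2 <= k.
Proof.
elim: n => //= n IHn lt_ng; have := IHn (ltnW lt_ng); have := size_walk w n.
case: (walk w n) => s c /= szs; rewrite leq_eqVlt.
case: ifP => //= [/asboolP[_]|_ le_ck]; last by rewrite leq_eqVlt.
by rewrite szs => le_gn /predU1P[ck|//]; move: lt_ng; rewrite ltnNge -ck le_gn.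
Qed.

(** Only the first k choices matter below height [g k], hence the k-tuples index
    all the nodes of that height. *)
Lemma few_patterns_thin_tree k : few_patterns (2 ^ k) (g k) (branches thin_tree).
Proof.
pose p (u : k.-tuple bool) : cantor_space :=
  fun i => nth false (walk (nth false u) (g k)).1 i.
exists [seq p u | u <- enum {: k.-tuple bool}]; split.
  by rewrite size_map -cardE card_tuple card_bool.
move=> x /(_ (g k)) /thin_tree_walk[w]; rewrite size_mkseq => xw.
have sz : size (mkseq w k) == k by rewrite size_mkseq.
exists (p (Tuple sz)); first by apply: map_f; rewrite mem_enum.
move=> i /= lt_ig; rewrite /p -(nth_mkseq false x lt_ig) xw.
congr (nth _ _.1 _); apply: eq_walk => c lt_c /=.
by rewrite nth_mkseq // (leq_trans lt_c) // walk_count_leq.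
Qed.

Hypothesis T_perfect : perfect_tree T.


Lemma perfect_tree_succ s : T s -> exists b, T (rcons s b).
Proof.
have [[_ Tpre] Tp] := T_perfect.
move=> /Tp[t [[Tt Tt0 _] /prefixP[[|b u] def_t]]].
  by exists false; rewrite def_t cats0 in Tt0.
by exists b; apply: Tpre Tt _; rewrite def_t -cat_rcons prefix_prefix.
Qed.

Lemma nonsplit_succ s b : T s -> ~ split_nodes T s -> T (rcons s b) ->
  b = ~~ `[< T (rcons s false) >].
Proof.
move=> Ts; case: b => nosplit Tsb; last by rewrite asboolT.
by rewrite asboolF // => Ts0; apply: nosplit.
Qed.

Lemma walkS_split w n : may_split (walk w n).1 (walk w n).2 ->
  walk w n.+1 = (rcons (walk w n).1 (w (walk w n).2), (walk w n).2.+1).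
Proof. by rewrite /=; case: (walk w n) => s c /= ->. Qed.

Lemma walkS_nosplit w n : ~~ may_split (walk w n).1 (walk w n).2 ->
  walk w n.+1 =
    (rcons (walk w n).1 (~~ `[< T (rcons (walk w n).1 false) >]), (walk w n).2).
Proof. by rewrite /=; case: (walk w n) => s c /= /negbTE->. Qed.

Lemma walk_sub w n : T (walk w n).1.
Proof.
elim: n => [|n IHn].
  by have [[[s Ts] Tpre] _] := T_perfect; apply: Tpre Ts (prefix0s s).
have [/[dup] /asboolP[[_ T0 T1] _]|] :=
    boolP (may_split (walk w n).1 (walk w n).2).
  by move/walkS_split->; case: (w _).
move/walkS_nosplit->; have [[] Tb] /= := perfect_tree_succ IHn.
  by have [|] := asboolP (T (rcons (walk w n).1 false)).
by rewrite asboolT.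
Qed.

Lemma thin_tree_sub : thin_tree `<=` T.
Proof. by move=> _ [w [n ->]]; apply: walk_sub. Qed.

(** If no splitting were granted above height n, the counter would stay constant,
    and above height [g c] the walk would meet no splitting node of T at all; but
    then it could not avoid the splitting node that perfectness provides. *)
Lemma walk_reaches_split w n :
  exists2 m, n <= m & may_split (walk w m).1 (walk w m).2.
Proof.
apply: contrapT => noreach.
have nosplit m : n <= m -> ~~ may_split (walk w m).1 (walk w m).2.
  by move=> le_nm; apply/negP => splits; apply: noreach; exists m.
pose c := (walk w n).2.
have count_const m : n <= m -> (walk w m).2 = c.
  move/subnKC <-; elim: (m - n) => [|d IHd]; first by rewrite addn0.
  by rewrite addnS walkS_nosplit // nosplit // leq_addr.
pose m := maxn n (g c).
have nosplitT k : m <= k -> ~ split_nodes T (walk w k).1.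
  rewrite geq_max => /andP[le_nk le_gk] splits.
  have /negP := nosplit k le_nk; apply.
  by apply/asboolP; rewrite count_const // size_walk.
have [[_ Tpre] Tp] := T_perfect.
have [t [splits]] := Tp _ (walk_sub w m).
rewrite prefixE size_walk => /eqP take_t.
have le_mt : m <= size t.
  by rewrite -(size_walk w m) -take_t size_take_min geq_minr.
have walk_t k : m + k <= size t -> (walk w (m + k)).1 = take (m + k) t.
  elim: k => [|k IHk]; first by rewrite addn0 take_t.
  rewrite addnS => lt_t; have {}IHk := IHk (ltnW lt_t).
  have le_n : n <= m + k by rewrite (leq_trans (leq_maxl n (g c))) ?leq_addr.
  rewrite walkS_nosplit ?nosplit //= (take_nth false) // -IHk; congr rcons.
  apply/esym/nonsplit_succ; [exact: walk_sub|exact/nosplitT/leq_addr|].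
  rewrite IHk -take_nth //; apply: Tpre (prefix_take _ _).
  by case: splits.
apply: (nosplitT (size t)) => //.
by have := walk_t (size t - m); rewrite subnKC // take_size => ->.
Qed.

(** The choice made at the splitting itself has not been read before, so it can be
    altered without changing the walk up to that node. *)
Lemma split_nodes_thin_tree w n : may_split (walk w n).1 (walk w n).2 ->
  split_nodes thin_tree (walk w n).1.
Proof.
move=> splits; suff thin_succ b : thin_tree (rcons (walk w n).1 b).
  by split; [exists w, n|apply: thin_succ|apply: thin_succ].
pose w' c := if c == (walk w n).2 then b else w c.
have eqw : walk w n = walk w' n.
  by apply: eq_walk => c lt_c; rewrite /w' ltn_eqF.
by exists w', n.+1; rewrite walkS_split -eqw //= /w' eqxx.
Qed.

Lemma perfect_thin_tree : perfect_tree thin_tree.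
Proof.
split; first split.
- by exists [::], (fun=> false), 0.
- move=> s _ [w [n ->]]; rewrite prefixE => /eqP <-; exists w.
  exists (minn (size s) n); rewrite -(take_walk _ (geq_minr _ _)).
  case: (leqP (size s) n) => // lt_ns.
  by rewrite !take_oversize ?size_walk // ltnW.
move=> _ [w [n ->]]; have [m le_nm splits] := walk_reaches_split w n.
exists (walk w m).1; split; first exact: split_nodes_thin_tree.
by rewrite -(take_walk _ le_nm) prefix_take.
Qed.

(** In a uniformly perfect tree the number of granted splittings depends on the
    height only, and so does the decision to grant the next one. *)
Lemma uniformly_perfect_thin_tree :
  uniformly_perfect_tree T -> uniformly_perfect_tree thin_tree.
Proof.
move=> [_ T_unif]; split; first exact: perfect_thin_tree.
have unif_split w w' n : (walk w n).2 = (walk w' n).2 ->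
    may_split (walk w n).1 (walk w n).2 ->
    may_split (walk w' n).1 (walk w' n).2.
  move=> eq_c /asboolP[splits]; rewrite eq_c size_walk => le_g.
  apply/asboolP; rewrite size_walk; split=> //.
  have [all_split|no_split] := T_unif n.
    by apply: all_split; split; [apply: size_walk|apply: walk_sub].
  suff : set0 (walk w n).1 by [].
  by rewrite -no_split; split=> //; apply: size_walk.
have unif_count w w' n : (walk w n).2 = (walk w' n).2.
  elim: n => // n IHn.
  have [splits|nosplit] := boolP (may_split (walk w n).1 (walk w n).2).
    by rewrite !walkS_split //= ?IHn //; exact: unif_split IHn splits.
  rewrite !walkS_nosplit //; apply: contra nosplit.
  by apply: unif_split; rewrite IHn.
move=> n; have [[w splits]|nosplit] :=
    pselect (exists w, may_split (walk w n).1 (walk w n).2).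
  left=> s [szs /thin_tree_walk[w' ->]]; rewrite szs.
  by apply: split_nodes_thin_tree; apply: unif_split splits.
right; rewrite -subset0 => s [szs [_ [w0 [n0 def0]] [w1 [n1 def1]]]].
have [] : n0 = n.+1 /\ n1 = n.+1.
  by rewrite -(size_walk w0 n0) -(size_walk w1 n1) -def0 -def1 !size_rcons szs.
move=> eqn0 eqn1; move: def0 def1; rewrite {}eqn0 {}eqn1.
have nosplits w : ~~ may_split (walk w n).1 (walk w n).2.
  by apply/negP => splits; apply: nosplit; exists w.
rewrite !walkS_nosplit // => /= /rcons_inj[<- b0] /rcons_inj[<- b1].
by rewrite -b0 in b1.
Qed.

End Thinning.

(** * Sums of a meager set with the branches of a thinned tree *)

(** The heights g are found before the tree is given.  The k-th long block ends at
    height [g k.+1], where the thinned tree has at most [2 ^ k.+1] nodes, and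
    [N k] dominates the n-th power of this number once k >= n. *)
Lemma meager_iter_sumset_thin_tree (F : set cantor_space) : meager F ->
  exists g, forall T n,
    meager (cantor_iter_sumset F (branches (thin_tree T g)) n).
Proof.
move=> /meager_sub_eventually_avoids[f [z [f_lt Fz]]].
pose N k := 2 ^ (k.+1 * k).
pose idx := fix idx k := if k is j.+1 then idx j + N j else 0.
exists (f \o idx) => T n; apply: meagerS (@iter_sumset_sub _ _ n) _.
apply: (@meager_sumset f z N idx _ _ n) => // k.
  by rewrite -[X in X < _]addn0 ltn_add2l expn_gt0.
move=> le_nk; apply: (@few_patternsW ((2 ^ k.+1) ^ n)).
  by rewrite -expnM leq_pexp2l // leq_mul2l le_nk orbT.
apply: few_patterns_iter_sumset.
exact: (@few_patterns_thin_tree T (f \o idx) k.+1).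
Qed.

Theorem theorem6 :
  (forall (F : set cantor_space) (T : set (seq bool)),
     meager F -> perfect_tree T ->
     exists T' : set (seq bool),
       [/\ perfect_tree T', T' `<=` T &
         forall n : nat, meager (cantor_iter_sumset F (branches T') n)])
  /\
  (forall (F : set cantor_space) (T : set (seq bool)),
     meager F -> uniformly_perfect_tree T ->
     exists T' : set (seq bool),
       [/\ uniformly_perfect_tree T', T' `<=` T &
         forall n : nat, meager (cantor_iter_sumset F (branches T') n)]).

Proof.
split=> F T /meager_iter_sumset_thin_tree[g meagerF] T_perfect;
  exists (thin_tree T g); split=> //.
- exact: perfect_thin_tree.
- exact: thin_tree_sub.
- by apply: uniformly_perfect_thin_tree; first case: T_perfect.
- by apply: thin_tree_sub; case: T_perfect.
Qed.
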